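(* Let $K:\mathcal X\to\mathcal Y$ be a compact linear operator with infinite dimensional range, and let $\{\alpha_n\}_{n\in\mathbb N},\{r_n\}_{n\in\mathbb N}$ be sequences of positive real numbers. The nonstationary iterated weighted Tikhonov (NSIWT) method converges, i.e. for every attainable $y$ the iterates $x_{\alpha_n,r_n}^n$ converge to $x^\dagger=K^\dagger y$ in $\mathcal X$ as $n\to\infty$, if and only if $$\sum_{k=1}^{n}\frac{\sigma^{r_k+1}}{\sigma^{r_k+1}+\alpha_k}$$ diverges (as $n\to\infty$) for every $\sigma>0$.
   Context: $\mathcal X,\mathcal Y$ are Hilbert spaces; $y$ attainable means $y\in R(K)$, the range of $K$; $K^\dagger$ is the Moore-Penrose generalized inverse. $(\sigma_m;v_m,u_m)_{m\in\mathbb N}$ is the singular value expansion of $K$ ($Kv_m=\sigma_mu_m$, $K^*u_m=\sigma_mv_m$, $\sigma_m>0$ decreasing to $0$). NSIWT: $x_{\alpha_0,r_0}^0=0$ and, for $n\ge1$, $$\big[(K^*K)^{\frac{r_n+1}2}+\alpha_nI\big]x_{\alpha_n,r_n}^n=(K^*K)^{\frac{r_n-1}2}K^*y+\alpha_nx_{\alpha_{n-1},r_{n-1}}^{n-1},$$ where $(K^*K)^{\frac{r-1}2}K^*y:=\sum_m\sigma_m^{r}\langle y,u_m\rangle v_m$. *)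

(* Defs.v *)
From HB Require Import structures.
From mathcomp Require Import all_boot all_order all_algebra.
From mathcomp Require Import sesquilinear.
From mathcomp Require Import complex.
From mathcomp Require Import boolp classical_sets functions reals.
From mathcomp Require Import topology normedtype sequences exp.

Set Implicit Arguments.
Unset Strict Implicit.
Unset Printing Implicit Defensive.

Import Order.TTheory GRing.Theory Num.Theory.
Import numFieldNormedType.Exports.

Local Open Scope classical_set_scope.
Local Open Scope ring_scope.

(* Hilbert spaces are real or complex; the two cases are treated uniformly by
   letting the scalar field depend on a flag. *)
Variant scalar_kind := RealScalars | ComplexScalars.

Definition scalar (R : realType) (k : scalar_kind) : numFieldType :=
  match k with
  | RealScalars => R
  | ComplexScalars => R[i]
  end.

Definition of_real {R : realType} {k : scalar_kind} : R -> scalar R k :=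
  match k return R -> scalar R k with
  | RealScalars => id
  | ComplexScalars => real_complex R
  end.

Definition scalar_conj {R : realType} {k : scalar_kind} :
    scalar R k -> scalar R k :=
  match k return scalar R k -> scalar R k with
  | RealScalars => id
  | ComplexScalars => fun z : R[i] => z^*
  end.

(* The inner product is linear in its first argument and conjugate-linear in
   its second one. *)
Record hilbertType (R : realType) (k : scalar_kind) := HilbertType {
  hilbert_sort :> completeNormedModType (scalar R k);
  dot : {dot hilbert_sort for @scalar_conj R k};
  sqr_norm_dot : forall x : hilbert_sort, `|x| ^+ 2 = dot x x
}.

Notation "''[' x , y ]" := (dot _ x y) : ring_scope.

Section Operators.
Variables (R : realType) (k : scalar_kind) (X Y : hilbertType R k).
Variable K : {linear X -> Y}.

Definition compact_operator : Prop :=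
  forall A : set X, bounded_set A -> precompact (K @` A).

Definition infinite_dim_range : Prop :=
  ~ exists (n : nat) (e : 'I_n -> Y),
      forall x : X, exists c : 'I_n -> scalar R k,
        K x = \sum_(i < n) c i *: e i.

(* For continuous K the defining property has exactly one solution (Riesz), so
   the default value 0 is never used. *)
Definition adjoint (y : Y) : X :=
  xget 0 [set x | forall z : X, '[K z, y] = '[z, x]].

Definition orthocomp (H : hilbertType R k) (A : set H) : set H :=
  [set x | forall a, A a -> '[x, a] = 0].

Definition null_space : set X := [set x | K x = 0].

(* The Moore-Penrose inverse is the linear extension of the inverse of the
   restriction of K to N(K)^_|_ to the domain R(K) + R(K)^_|_ that vanishes on
   R(K)^_|_; below is its graph. *)
Definition moore_penrose_graph (y : Y) (x : X) : Prop :=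
  exists w z : Y, [/\ y = w + z, orthocomp (range K) z,
                      orthocomp null_space x & K x = w].

(* Outside the domain R(K) + R(K)^_|_ the value is the irrelevant default 0. *)
Definition moore_penrose (y : Y) : X := xget 0 (moore_penrose_graph y).

Definition orthonormal_seq (H : hilbertType R k) (e : nat -> H) : Prop :=
  forall m n, '[e m, e n] = (m == n)%:R.

Record singular_value_expansion
    (sigma : nat -> R) (v : nat -> X) (u : nat -> Y) : Prop := {
  sve_gt0 : forall m, 0 < sigma m;
  sve_decreasing : nonincreasing_seq sigma;
  sve_cvg0 : sigma @ \oo --> 0;
  sve_v_orthonormal : orthonormal_seq v;
  sve_u_orthonormal : orthonormal_seq u;
  sve_image : forall m, K (v m) = of_real (sigma m) *: u m;
  sve_adjoint : forall m, adjoint (u m) = of_real (sigma m) *: v m;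
  sve_expansion : forall x : X,
    series (fun m => (of_real (sigma m) * '[x, v m]) *: u m) @ \oo --> K x;
  sve_adjoint_expansion : forall y : Y,
    series (fun m => (of_real (sigma m) * '[y, u m]) *: v m) @ \oo
      --> adjoint y
}.

End Operators.

Section NSIWT.
Variables (R : realType) (k : scalar_kind) (X Y : hilbertType R k).
Variables (sigma : nat -> R) (v : nat -> X) (u : nat -> Y).

(* (K^* K)^s x for s > 0, by functional calculus: the nonzero eigenvalues of
   K^* K are the sigma_m ^ 2, and N(K) is mapped to 0. *)
Definition normal_power (s : R) (x : X) : X :=
  limn (series (fun m => (of_real ((sigma m ^+ 2) `^ s) * '[x, v m]) *: v m)).

(* (K^* K)^((r - 1) / 2) K^* y; the exponent (r - 1) / 2 may be negative. *)
Definition weighted_adjoint (r : R) (y : Y) : X :=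
  limn (series (fun m => (of_real (sigma m `^ r) * '[y, u m]) *: v m)).

(* The operator (K^* K)^((r + 1) / 2) + a I is invertible for a > 0, so the
   equation has exactly one solution and the default value 0 is never used. *)
Definition nsiwt_step (a r : R) (y : Y) (z : X) : X :=
  xget 0 [set x | normal_power ((r + 1) / 2) x + of_real a *: x
                  = weighted_adjoint r y + of_real a *: z].

Fixpoint nsiwt (alpha r : nat -> R) (y : Y) (n : nat) : X :=
  if n is n'.+1 then nsiwt_step (alpha n) (r n) y (nsiwt alpha r y n') else 0.

End NSIWT.

(* Main.v *)
Require Import Defs.
From HB Require Import structures.
From mathcomp Require Import all_boot all_order all_algebra.
From mathcomp Require Import sesquilinear.
From mathcomp Require Import complex.
From mathcomp Require Import boolp classical_sets functions reals.
From mathcomp Require Import topology normedtype sequences exp.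
From mathcomp Require Import ring lra.

Set Implicit Arguments.
Unset Strict Implicit.
Unset Printing Implicit Defensive.

Import Order.TTheory GRing.Theory Num.Theory.
Import numFieldNormedType.Exports.

Local Open Scope classical_set_scope.
Local Open Scope ring_scope.

(** In the singular basis every operator of the method is diagonal. Write
    [D(w)] for the operator that sends [x] to the sum of [w_m <x, v_m> v_m].
    For [y = K x] one has [<y, u_m> = sigma_m <x, v_m>], so that both
    [(K^*K)^((r+1)/2)] applied to a vector and the data term
    [(K^*K)^((r-1)/2) K^*] applied to [y] are given by the weights
    [sigma_m^(r+1)], and [K^dagger y = D(1) x], the projection of [x] on the
    closed span of the [v_m], that is, on [N(K)^_|_] ([moore_penrose_K]).

    Solving the iteration one coefficient at a time, the m-th coefficient of the
    error is multiplied at step [j] by [1 - t_j(sigma_m)], with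
    [t_j(s) = s^(r_j+1) / (s^(r_j+1) + alpha_j)] and [0 <= t_j < 1]. Hence the
    n-th iterate is [D(1 - P_n) x], where [P_n(m)] is the product of the factors
    [1 - t_j(sigma_m)] for [1 <= j <= n] ([nsiwt_step_diag], [nsiwt_diag]).

    The error [D(P_n) x] tends to [0] for every [x] if and only if [P_n(m)]
    tends to [0] for every [m] ([nsiwt_cvgP]). Necessity follows from [x = v_m];
    sufficiency is dominated convergence: since [0 <= P_n <= 1], Bessel's
    inequality makes the tail of the series small uniformly in [n]
    ([fourier_tail], [cvg_diag0]). An infinite product of factors [1 - t_j] with
    [0 <= t_j < 1] vanishes if and only if the sum of the [t_j] diverges
    ([prod_cvg0P]). This gives the criterion at the points [sigma_m] only;
    because [t_j] is nondecreasing in [s] and [sigma_m] tends to [0],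
    divergence at all [sigma_m] is divergence at all [s > 0]. *)

(** * Real numbers inside the real or complex scalars *)

Section Scalars.
Variables (R : realType) (k : scalar_kind).
Local Notation of_real := (@of_real R k).

Lemma of_realD a b : of_real (a + b) = of_real a + of_real b.
Proof. by case: k => //=; rewrite rmorphD. Qed.

Lemma of_realB a b : of_real (a - b) = of_real a - of_real b.
Proof. by case: k => //=; rewrite rmorphB. Qed.

Lemma of_realM a b : of_real (a * b) = of_real a * of_real b.
Proof. by case: k => //=; rewrite rmorphM. Qed.

Lemma of_real0 : of_real 0 = 0.
Proof. by case: k. Qed.

Lemma of_real1 : of_real 1 = 1.
Proof. by case: k. Qed.

Lemma of_real_le a b : (of_real a <= of_real b) = (a <= b).
Proof. by case: k => //=; exact: lecR. Qed.

Lemma of_real_lt a b : (of_real a < of_real b) = (a < b).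
Proof. by case: k => //=; exact: ltcR. Qed.

Lemma norm_of_real a : `|of_real a| = of_real `|a|.
Proof.
by case: k => //=; rewrite normc_def /= expr0n /= addr0 sqrtr_sqr.
Qed.

Lemma ge0_of_real (z : Defs.scalar R k) :
  0 <= z -> exists2 a, 0 <= a & z = of_real a.
Proof.
move: z; case: k => /= z z0; first by exists z.
have /complex_realP[a za] := ger0_real z0.
by exists a => //; rewrite za ler0c in z0 *.
Qed.

Lemma scalar_conj0 : scalar_conj (0 : Defs.scalar R k) = 0.
Proof. by case: k => //=; exact: conjc0. Qed.

Lemma cvg_of_real (a : nat -> R) l :
  (fun n => of_real (a n)) @ \oo --> of_real l <-> a @ \oo --> l.
Proof.
split=> /cvgrPdist_lt h; apply/cvgrPdist_lt => e e0.
  have /h : 0 < of_real e by rewrite -of_real0 of_real_lt.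
  by apply: filterS => n; rewrite -of_realB norm_of_real of_real_lt.
have [e' e'0 ee'] := ge0_of_real (ltW e0).
move: e0; rewrite ee' -of_real0 of_real_lt => /h.
by apply: filterS => n; rewrite -of_realB norm_of_real of_real_lt.
Qed.

(** Monotone convergence in [R]; it applies to complex scalars too because
    nonnegative complex numbers are real. *)
Lemma ge0_bounded_series_tail
    (t : nat -> Defs.scalar R k) (B : Defs.scalar R k) :
  (forall m, 0 <= t m) -> (forall n, \sum_(0 <= m < n) t m <= B) ->
  forall eps, 0 < eps ->
  exists N, forall n p, (N <= n)%N -> \sum_(n <= m < p) t m < eps.
Proof.
move=> t0 tB eps eps0.
have /choice[a atE] : forall m, exists a, 0 <= a /\ t m = of_real a.
  by move=> m; have [a a0 ->] := ge0_of_real (t0 m); exists a.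
have [B' _ BE] : exists2 b, 0 <= b & B = of_real b.
  by apply: ge0_of_real; have := tB 0; rewrite big_geq.
have [e _ epsE] := ge0_of_real (ltW eps0).
have sumE n p : \sum_(n <= m < p) t m = of_real (\sum_(n <= m < p) a m).
  rewrite (big_morph _ of_realD of_real0).
  by apply: eq_bigr => m _; rewrite (atE m).2.
have : cvgn (series a).
  apply: nondecreasing_is_cvgn.
    by apply: nondecreasing_series => m _ _; exact: (atE m).1.
  exists B' => _ [n _ <-]; rewrite -of_real_le -BE.
  by rewrite /series /= -sumE.
move/cauchy_cvgP/cauchy_seriesP => /(_ e).
rewrite -of_real_lt of_real0 -epsE => /(_ eps0).
move=> [[P Q]] /= [[N _ hN] [M _ hM]] PQ.
exists (maxn N M) => n p; rewrite geq_max => /andP[Nn Mn].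
rewrite sumE epsE of_real_lt.
have [pn|np] := leqP p n.
  by rewrite big_geq // -of_real_lt of_real0 -epsE.
apply: le_lt_trans (ler_norm _) (PQ (n, p) _).
by split; [apply: hN | apply: hM; exact: leq_trans (ltnW np)].
Qed.

End Scalars.

(** * Inner products and orthonormal sequences *)

Section InnerProduct.
Variables (R : realType) (k : scalar_kind) (H : hilbertType R k).
Implicit Types x y z a : H.

(** The rules of sesquilinear forms are restated for [dot] itself, so that
    rewriting with them does not leave the inner product seen as a weaker kind
    of form, which would no longer match syntactically. *)
Lemma dotDl x y z : '[x + y, z] = '[x, z] + '[y, z].
Proof. exact: linearDl. Qed.

Lemma dotBl x y z : '[x - y, z] = '[x, z] - '[y, z].
Proof. exact: linearBl. Qed.

Lemma dotZl c x y : '[c *: x, y] = c * '[x, y].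
Proof. exact: linearZl_LR. Qed.

Lemma dot_suml I (s : seq I) (P : pred I) (f : I -> H) y :
  '[\sum_(i <- s | P i) f i, y] = \sum_(i <- s | P i) '[f i, y].
Proof. exact: linear_sumlz. Qed.

Lemma dotDr x y z : '[x, y + z] = '[x, y] + '[x, z].
Proof. exact: linearDr. Qed.

Lemma dotZr c x y : '[x, c *: y] = scalar_conj c * '[x, y].
Proof. exact: linearZr_LR. Qed.

Lemma dot0r x : '[x, 0] = 0.
Proof. exact: linear0r. Qed.

Lemma dot_sumr I (s : seq I) (P : pred I) (f : I -> H) x :
  '[x, \sum_(i <- s | P i) f i] = \sum_(i <- s | P i) '[x, f i].
Proof. exact: linear_sumr. Qed.

Lemma dotC x y : '[x, y] = scalar_conj '[y, x].
Proof. by rewrite -[RHS]mul1r; exact: hermitian_subproof. Qed.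

Lemma dot_eq0C x y : '[x, y] = 0 -> '[y, x] = 0.
Proof. by move=> xy; rewrite dotC xy scalar_conj0. Qed.

Lemma dotxx_gt0 x : x != 0 -> 0 < '[x, x].
Proof. by rewrite -sqr_norm_dot -normr_gt0 => /exprn_gt0. Qed.

Lemma pythagoras x y : '[x, y] = 0 -> `|x + y| ^+ 2 = `|x| ^+ 2 + `|y| ^+ 2.
Proof.
move=> xy; rewrite !sqr_norm_dot dotDl !dotDr.
by rewrite xy (dot_eq0C xy) addr0 add0r.
Qed.

(** Pythagoras applied to the orthogonal projection of [x] on the line spanned
    by [a]. *)
Lemma cauchy_schwarz x a : `|'[x, a]| <= `|x| * `|a|.
Proof.
have [->|a0] := eqVneq a 0; first by rewrite dot0r !normr0 mulr0.
have aa0 := dotxx_gt0 a0.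
set c := '[x, a] / '[a, a].
have xaE : '[x, a] = c * '[a, a] by rewrite /c divfK // gt_eqF.
have ca_rest : '[c *: a, x - c *: a] = 0.
  by apply: dot_eq0C; rewrite dotZr dotBl dotZl xaE subrr mulr0.
have := pythagoras ca_rest; rewrite addrC subrK => xE.
have : `|c *: a| <= `|x|.
  by rewrite -ler_sqr ?nnegrE // xE lerDl exprn_ge0.
rewrite xaE -sqr_norm_dot normrM normrX normr_id normrZ expr2 mulrA => h.
by rewrite ler_wpM2r.
Qed.

Lemma cvg_dotl (x_ : nat -> H) x a :
  x_ @ \oo --> x -> (fun n => '[x_ n, a]) @ \oo --> '[x, a].
Proof.
move=> /cvgrPdist_lt xx; apply/cvgrPdist_lt => e e0.
have a1 : 0 < `|a| + 1 by rewrite ltr_wpDl.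
have /xx : 0 < e / (`|a| + 1) by rewrite divr_gt0.
apply: filterS => n; rewrite ltr_pdivlMr // -dotBl => h.
apply: le_lt_trans (cauchy_schwarz _ _) (le_lt_trans _ h).
by rewrite ler_wpM2l // lerDl.
Qed.

Lemma dot_sum_orthonormal (e : nat -> H) (c : nat -> Defs.scalar R k) n p j :
  orthonormal_seq e ->
  '[\sum_(n <= m < p) c m *: e m, e j] = if (n <= j < p)%N then c j else 0.
Proof.
move=> eo; rewrite dot_suml.
under eq_bigr do rewrite dotZl eo.
case: ifPn => jnp.
  rewrite (bigD1_seq j) ?mem_index_iota ?iota_uniq //= eqxx mulr1.
  rewrite big1 ?addr0 //.
  by move=> i /negPf ->; rewrite mulr0.
rewrite big_seq big1 // => i; rewrite mem_index_iota => inp.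
by case: eqP => [ij|_]; rewrite ?mulr0 //; rewrite -ij inp in jnp.
Qed.

Lemma dot_lim_series (e : nat -> H) (c : nat -> Defs.scalar R k) s j :
  orthonormal_seq e ->
  series (fun m => c m *: e m) @ \oo --> s -> '[s, e j] = c j.
Proof.
move=> eo cs; have h := cvg_dotl (a := e j) cs.
apply: (cvg_unique _ h) => //=.
apply: cvg_near_cst; exists j.+1 => // n /= jn.
by rewrite /series /= dot_sum_orthonormal // leq0n jn.
Qed.

Lemma sqr_norm_sum_orthonormal (e : nat -> H) (c : nat -> Defs.scalar R k) n p :
  orthonormal_seq e ->
  `|\sum_(n <= m < p) c m *: e m| ^+ 2 = \sum_(n <= m < p) `|c m| ^+ 2.
Proof.
move=> eo; have [pn|/ltnW] := leqP p n.
  by rewrite !big_geq // normr0 expr0n.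
elim: p => [|p IH].
  by rewrite leqn0 => /eqP ->; rewrite !big_geq // normr0 expr0n.
rewrite leq_eqVlt => /predU1P[->|]; first by rewrite !big_geq // normr0 expr0n.
rewrite ltnS => np; rewrite !big_nat_recr //= -IH // pythagoras.
  by rewrite normrZ exprMn (sqr_norm_dot (e p)) eo eqxx mulr1.
by rewrite dotZr dot_sum_orthonormal // ltnn andbF mulr0.
Qed.

(** Pythagoras again: the partial sum [S] of the Fourier series of [x] is
    orthogonal to [x - S]. *)
Lemma bessel (e : nat -> H) x n : orthonormal_seq e ->
  \sum_(0 <= m < n) `|'[x, e m]| ^+ 2 <= `|x| ^+ 2.
Proof.
move=> eo; rewrite -(sqr_norm_sum_orthonormal (fun m => '[x, e m]) 0 n eo).
set S := \sum_(_ <= m < _) _.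
have : '[S, x - S] = 0.
  apply: dot_eq0C; rewrite {2}/S dot_sumr big_seq big1 // => m.
  rewrite mem_index_iota => mn.
  by rewrite dotZr dotBl dot_sum_orthonormal // mn subrr mulr0.
by move/pythagoras; rewrite addrC subrK => ->; rewrite lerDl exprn_ge0.
Qed.

End InnerProduct.

(** * Diagonal operators along an orthonormal sequence *)

Section Diagonal.
Variables (R : realType) (k : scalar_kind) (H : hilbertType R k).
Variable e : nat -> H.
Hypothesis eo : orthonormal_seq e.
Implicit Types (x : H) (w : nat -> R).
Local Notation of_real := (@of_real R k).

Definition diag w x : H :=
  limn (series (fun m => (of_real (w m) * '[x, e m]) *: e m)).

Definition bounded_weights w := exists B, forall m, `|w m| <= B.

(** The index [N] depends on the bound [B] but not on the weights: this
    uniformity is what makes dominated convergence work in [cvg_diag0]. *)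
Lemma fourier_tail x (B : R) eps : 0 < eps -> exists N, forall n p w,
  (N <= n)%N -> (forall m, `|w m| <= B) ->
  `|\sum_(n <= m < p) (of_real (w m) * '[x, e m]) *: e m| < eps.
Proof.
move=> eps0; pose C := of_real (`|B| + 1).
have C0 : 0 < C by rewrite /C -(of_real0 R k) of_real_lt ltr_wpDl.
have [|||N hN] := @ge0_bounded_series_tail R k (fun m => `|'[x, e m]| ^+ 2)
    (`|x| ^+ 2) _ _ ((eps / C) ^+ 2).
- by move=> m; rewrite exprn_ge0.
- by move=> n; exact: bessel.
- by rewrite exprn_gt0 // divr_gt0.
exists N => n p w Nn wB.
rewrite -ltr_sqr ?nnegrE ?(ltW eps0) //.
rewrite (sqr_norm_sum_orthonormal (fun m => of_real (w m) * '[x, e m]) n p eo).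
apply: (@le_lt_trans _ _ (C ^+ 2 * \sum_(n <= m < p) `|'[x, e m]| ^+ 2)).
  rewrite mulr_sumr; apply: ler_sum => m _.
  rewrite normrM exprMn ler_wpM2r ?exprn_ge0 //.
  rewrite ler_sqr ?nnegrE //; last exact: ltW.
  rewrite /C norm_of_real of_real_le (le_trans (wB m)) //.
  by rewrite (le_trans (ler_norm B)) // lerDl.
by rewrite mulrC -ltr_pdivlMr ?exprn_gt0 // -expr_div_n hN.
Qed.

Lemma cvg_diag w x : bounded_weights w ->
  series (fun m => (of_real (w m) * '[x, e m]) *: e m) @ \oo --> diag w x.
Proof.
move=> [B wB].
apply/cauchy_cvgP/cauchy_seriesP => eps /(fourier_tail x B)[N hN].
exists ([set n | (N <= n)%N], setT) => /=.
  by split; [exists N | exact: filterT].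
by move=> [n p] /= [Nn _]; exact: hN.
Qed.

Arguments cvg_diag [w] x _.

Lemma dot_diag w x m : bounded_weights w ->
  '[diag w x, e m] = of_real (w m) * '[x, e m].
Proof.
move=> wb.
exact: (@dot_lim_series _ _ _ _ (fun j => of_real (w j) * '[x, e j]) _ m eo
  (cvg_diag x wb)).
Qed.

Lemma bounded_cst (c : R) : bounded_weights (fun=> c).
Proof. by exists `|c|. Qed.

Lemma eq_diag w w' x y :
  (forall m, of_real (w m) * '[x, e m] = of_real (w' m) * '[y, e m]) ->
  diag w x = diag w' y.
Proof.
move=> h; rewrite /diag; congr (limn (series _)).
by apply: funext => m; rewrite h.
Qed.

Lemma diagB w w' x : bounded_weights w -> bounded_weights w' ->
  diag (fun m => w m - w' m) x = diag w x - diag w' x.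
Proof.
move=> wb w'b; apply: cvg_lim => //.
apply: cvg_trans (cvgB (cvg_diag x wb) (cvg_diag x w'b)).
apply: near_eq_cvg; apply: nearW => n; rewrite !fctE /series /= -sumrB.
by apply: eq_bigr => m _; rewrite of_realB mulrBl scalerBl.
Qed.

Lemma diagD w w' x : bounded_weights w -> bounded_weights w' ->
  diag (fun m => w m + w' m) x = diag w x + diag w' x.
Proof.
move=> wb w'b; apply: cvg_lim => //.
apply: cvg_trans (cvgD (cvg_diag x wb) (cvg_diag x w'b)).
apply: near_eq_cvg; apply: nearW => n; rewrite !fctE /series /= -big_split.
by apply: eq_bigr => m _; rewrite of_realD mulrDl scalerDl.
Qed.

Lemma diagZ w a x : bounded_weights w ->
  diag (fun m => a * w m) x = of_real a *: diag w x.
Proof.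
move=> wb; apply: cvg_lim => //.
apply: cvg_trans (cvgZl_tmp (k := of_real a) (cvg_diag x wb)).
apply: near_eq_cvg; apply: nearW => n; rewrite /series /= scaler_sumr.
by apply: eq_bigr => m _; rewrite of_realM -mulrA scalerA.
Qed.

Lemma diag_diag w w' x : bounded_weights w' ->
  diag w (diag w' x) = diag (fun m => w m * w' m) x.
Proof.
by move=> wb; apply: eq_diag => m; rewrite dot_diag // of_realM mulrA.
Qed.

(** Dominated convergence: the tail of the series is small uniformly in [n] and
    the head is a finite sum of null sequences. *)
Lemma cvg_diag0 (w_ : nat -> nat -> R) x (B : R) :
  (forall n m, `|w_ n m| <= B) -> (forall m, w_ ^~ m @ \oo --> 0) ->
  diag (w_ n) x @[n --> \oo] --> 0.
Proof.
move=> wB w0; apply/cvgr0Pnorm_le => eps eps0.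
have eps2 : 0 < eps / 2 by rewrite divr_gt0.
have [N hN] := fourier_tail x B eps2.
have head0 : (fun n =>
    series (fun m => (of_real (w_ n m) * '[x, e m]) *: e m) N) @ \oo --> 0.
  rewrite (_ : 0 = \sum_(0 <= m < N) 0 :> H); last by rewrite big1.
  apply: cvg_big => [|m _]; first exact: add_continuous.
  rewrite -(scale0r (e m)) -(mul0r '[x, e m]).
  apply: cvgZr_tmp; apply: cvgMr_tmp.
  by rewrite -(of_real0 R k); apply/cvg_of_real; exact: w0.
have wb n : bounded_weights (w_ n) by exists B; exact: wB.
move/cvgr0Pnorm_lt: head0 => /(_ _ eps2); apply: filterS => n hn.
set S := series _ in hn.
have /cvgrPdist_lt := cvg_diag x (wb n).
move=> tail; apply/ler_addgt0Pr => d d0; rewrite (splitr eps).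
have [p [+ pN]] : exists p, `|diag (w_ n) x - S p| < d /\ (N <= p)%N.
  have [M _ hM] := tail d d0; exists (maxn M N).
  by split; [apply: hM; exact: leq_maxl | exact: leq_maxr].
move=> /ltW dp; rewrite -(subrK (S p) (diag _ _)) addrC.
apply: le_trans (ler_normD _ _) (lerD _ dp).
rewrite -(subrK (S N) (S p)) (le_trans (ler_normD _ _)) // lerD //;
  last exact: ltW.
by rewrite /S sub_series_geq // ltW // hN.
Qed.

End Diagonal.
Arguments cvg_diag {R k H e} eo {w} x _.

(** * Infinite products of factors in ]0, 1] *)

Section RealProducts.
Variables (R : realType) (t : nat -> R).
Hypothesis t01 : forall j, 0 <= t j < 1.

Lemma weierstrass_product n p :
  1 - \sum_(n <= j < p) t j <= \prod_(n <= j < p) (1 - t j).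
Proof.
have [pn|/ltnW] := leqP p n; first by rewrite !big_geq // subr0.
elim: p => [|p IH].
  by rewrite leqn0 => /eqP ->; rewrite !big_geq // subr0.
rewrite leq_eqVlt => /predU1P[->|]; first by rewrite !big_geq // subr0.
rewrite ltnS => np; rewrite !big_nat_recr //=.
have := IH np; have /andP[] := t01 p.
have : 0 <= \sum_(n <= j < p) t j.
  by apply: sumr_ge0 => j _; have /andP[] := t01 j.
nra.
Qed.

(** A quantitative form of [1 - t <= exp (- t)], without the exponential: it
    rests on [(1 - t) (1 + S + t) <= 1 + S] for nonnegative [S] and [t]. *)
Lemma prod_mul_sum_le1 n :
  \prod_(0 <= j < n) (1 - t j) * (1 + \sum_(0 <= j < n) t j) <= 1.
Proof.
elim: n => [|n IH]; first by rewrite !big_geq // addr0 mulr1.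
rewrite !big_nat_recr //=; apply: le_trans IH.
have S0 : 0 <= \sum_(0 <= j < n) t j.
  by apply: sumr_ge0 => j _; have /andP[] := t01 j.
rewrite -mulrA ler_wpM2l //.
  by apply: prodr_ge0 => j _; have /andP[_ /ltW] := t01 j; rewrite subr_ge0.
have /andP[] := t01 n; nra.
Qed.

(** If the sum converges, all terms from some index [L] on add up to less than
    [1/2], and by [weierstrass_product] the product stays above half of its
    first [L] factors. If it diverges, [prod_mul_sum_le1] bounds the product
    by the inverse of the partial sums. *)
Lemma prod_cvg0P :
  (fun n => \prod_(0 <= j < n) (1 - t j)) @ \oo --> 0 <-> ~ cvgn (series t).
Proof.
have P_gt0 n : 0 < \prod_(0 <= j < n) (1 - t j).
  by apply: prodr_gt0 => j _; have /andP[_] := t01 j; rewrite subr_gt0.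
split=> [/cvgr0Pnorm_lt P0|dvg].
  move=> /cauchy_cvgP/cauchy_seriesP/(_ (1 / 2)) [|[A B]]; first by lra.
  move=> /= [[N _ hN] [M _ hM]] tail.
  pose L := maxn N M.
  have /P0 [L' _ hL'] : 0 < (\prod_(0 <= j < L) (1 - t j)) / 2.
    by rewrite divr_gt0.
  have /hL' : (L' <= maxn L L')%N by exact: leq_maxr.
  set n := maxn L L'; have Ln : (L <= n)%N by exact: leq_maxl.
  have := tail (L, n); rewrite /= => /(_ _) tailLn.
  have /tailLn : A L /\ B n.
    split; [apply: hN; exact: leq_maxl | apply: hM].
    by apply: leq_trans Ln; exact: leq_maxr.
  move=> /ltr_normlW ts; rewrite gtr0_norm //=.
  rewrite (big_cat_nat (n := L)) //= => h.
  have := weierstrass_product L n; have := P_gt0 L.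
  move: h ts; set a := \prod_(0 <= j < L) _; set b := \prod_(L <= j < n) _.
  by nra.
apply/cvgr0Pnorm_lt => eps eps0.
have [N hN] : exists N, eps^-1 < \sum_(0 <= j < N) t j.
  apply: contrapT => /forallNP h; apply: dvg; apply: nondecreasing_is_cvgn.
    by apply: nondecreasing_series => j _ _; have /andP[] := t01 j.
  by exists eps^-1 => _ [n _ <-]; rewrite leNgt; exact/negP/h.
exists N => // n /= Nn; rewrite gtr0_norm //.
have : \sum_(0 <= j < N) t j <= \sum_(0 <= j < n) t j.
  have nd : nondecreasing_seq (series t).
    by apply: nondecreasing_series => j _ _; have /andP[] := t01 j.
  exact: nd.
move=> /(lt_le_trans hN); rewrite -(@ltr_pM2r _ eps) // mulVf ?gt_eqF // => h.
have := prod_mul_sum_le1 n; have := P_gt0 n.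
by move: h; set a := \prod_(_ <= _ < _) _; set b := \sum_(_ <= _ < _) _; nra.
Qed.

End RealProducts.

(** * Filter factors of the iteration *)

Section FilterFactors.
Variables (R : realType) (alpha r : nat -> R).
Hypotheses (alpha_gt0 : forall n, 0 < alpha n) (r_gt0 : forall n, 0 < r n).

Definition filter_factor s j := s `^ (r j + 1) / (s `^ (r j + 1) + alpha j).

(** The part of a coefficient, for the singular value [s], that is still missing
    after [n] steps. The parameters of the first step have index 1. *)
Definition residual s n := \prod_(0 <= j < n) (1 - filter_factor s j.+1).

Lemma filter_factor01 s j : 0 <= filter_factor s j < 1.
Proof.
have s0 : 0 <= s `^ (r j + 1) by exact: powR_ge0.
rewrite divr_ge0 ?addr_ge0 ?(ltW (alpha_gt0 j)) //=.
by rewrite ltr_pdivrMr ?ltr_wpDl // mul1r ltrDl.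
Qed.

Lemma le_filter_factor s s' j : 0 < s -> s <= s' ->
  filter_factor s j <= filter_factor s' j.
Proof.
move=> s0 ss'.
have : s `^ (r j + 1) <= s' `^ (r j + 1).
  apply: ge0_ler_powR; rewrite ?nnegrE ?addr_ge0 ?(ltW (r_gt0 j)) //.
    exact: ltW.
  exact: le_trans (ltW s0) ss'.
have := powR_ge0 s (r j + 1); have := alpha_gt0 j; rewrite /filter_factor.
move: (s `^ _) (s' `^ _) => b c a0 b0 bc.
rewrite ler_pdivrMr ?ltr_wpDl // mulrAC ler_pdivlMr ?ltr_wpDl //; first nra.
exact: le_trans bc.
Qed.

Lemma residual01 s n : 0 <= residual s n <= 1.
Proof.
rewrite /residual; apply/andP; split.
  by apply: prodr_ge0 => j _; have := filter_factor01 s j.+1; lra.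
by apply: prodr_ile1 => j _; have := filter_factor01 s j.+1; lra.
Qed.

End FilterFactors.

(** * The iteration in the singular basis *)

Section SVE.
Variables (R : realType) (k : scalar_kind) (X Y : hilbertType R k).
Variables (K : {linear X -> Y}).
Variables (sigma : nat -> R) (v : nat -> X) (u : nat -> Y).
Hypothesis K_sve : singular_value_expansion K sigma v u.
Local Notation of_real := (@of_real R k).

Let sigma_gt0 m : 0 < sigma m := sve_gt0 K_sve m.
Let vo : orthonormal_seq v := sve_v_orthonormal K_sve.
Let uo : orthonormal_seq u := sve_u_orthonormal K_sve.

Lemma bounded_powR_sigma p : 0 <= p -> bounded_weights (fun m => sigma m `^ p).
Proof.
move=> p0; exists (sigma 0%N `^ p) => m; rewrite ger0_norm ?powR_ge0 //.
apply: ge0_ler_powR; rewrite ?nnegrE ?(ltW (sigma_gt0 _)) //.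
exact: (sve_decreasing K_sve).
Qed.

Lemma dot_K x m : '[K x, u m] = of_real (sigma m) * '[x, v m].
Proof.
exact: (@dot_lim_series _ _ _ _ (fun j => of_real (sigma j) * '[x, v j]) _ m uo
  (sve_expansion K_sve (x := x))).
Qed.

Lemma eq_K x y : (forall m, '[x, v m] = '[y, v m]) -> K x = K y.
Proof.
move=> xy; apply: (cvg_unique _ (sve_expansion K_sve (x := x))) => //=.
rewrite (_ : series _ =
  series (fun m => (of_real (sigma m) * '[y, v m]) *: u m)).
  exact: sve_expansion.
by congr series; apply: funext => m; rewrite xy.
Qed.

Lemma dot_null_space x m : null_space K x -> '[x, v m] = 0.
Proof.
move=> Kx; have := dot_K x m; rewrite Kx => /esym/eqP.
rewrite (_ : '[0, u m] = 0); last by apply: dot_eq0C; exact: dot0r.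
rewrite mulf_eq0 => /predU1P[s0|/eqP //].
by have := sigma_gt0 m; rewrite -(of_real_lt k) s0 of_real0 ltxx.
Qed.

(** The right-hand side is the projection of [x] on the closed span of the [v_m].
    It has the same coefficients as [x], hence the same image, and is orthogonal
    to [N(K)] because all [v_m] are; these two properties determine it. *)
Lemma moore_penrose_K x : moore_penrose K (K x) = diag v (fun=> 1) x.
Proof.
set xd := diag _ _ _.
have KxdE : K xd = K x.
  by apply: eq_K => m; rewrite dot_diag ?of_real1 ?mul1r //; exact: bounded_cst.
have xd_perp : orthocomp (null_space K) xd.
  move=> a Ka.
  have h := cvg_dotl (a := a) (cvg_diag vo x (bounded_cst 1)).
  apply: (cvg_unique _ h) => //=.
  apply: cvg_near_cst; apply: nearW => n.
  rewrite dot_suml big1 // => m _.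
  by rewrite dotZl (dot_eq0C (dot_null_space m Ka)) mulr0.
have xdP : moore_penrose_graph K (K x) xd.
  exists (K x), 0; split=> //; first by rewrite addr0.
  by move=> a _; apply: dot_eq0C; exact: dot0r.
rewrite /moore_penrose; case: xgetP => [x' _|/(_ xd) //].
move=> [w [z [Kxwz z_perp x'_perp Kx'w]]].
(* z lies in the range of K and is orthogonal to it. *)
have z0 : z = 0.
  apply/eqP; apply: contraT => /dotxx_gt0; rewrite z_perp ?ltxx //.
  by exists (x - x') => //; rewrite raddfB /= Kx'w Kxwz addrAC subrr add0r.
apply/eqP; rewrite -subr_eq0; apply: contraT => /dotxx_gt0.
have xx'_null : null_space K (x' - xd).
  by rewrite /null_space /= raddfB /= Kx'w KxdE Kxwz z0 addr0 subrr.
by rewrite {1}dotBl x'_perp // xd_perp // subrr ltxx.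
Qed.

Section Step.
Variables (r a : R).
Hypotheses (r_gt0 : 0 < r) (a_gt0 : 0 < a).

Lemma normal_powerE x :
  normal_power sigma v ((r + 1) / 2) x = diag v (fun m => sigma m `^ (r + 1)) x.
Proof.
apply: eq_diag => m; congr (of_real _ * _).
rewrite -powR_mulrn ?ltW // -powRrM; congr (_ `^ _); lra.
Qed.

(** For attainable data the factor [sigma_m] of [dot_K] raises the exponent from
    [r] to [r + 1]. *)
Lemma weighted_adjointE x :
  weighted_adjoint sigma v u r (K x) = diag v (fun m => sigma m `^ (r + 1)) x.
Proof.
rewrite /weighted_adjoint /diag; congr (limn (series _)); apply: funext => m.
rewrite dot_K mulrA -of_realM powRD ?powRr1 ?ltW //.
by rewrite (gt_eqF (sigma_gt0 m)) implybT.
Qed.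

(** Taking inner products with [v_m] shows that [x] and [y] have the same
    coefficients; then the two powers agree and can be cancelled, which leaves
    [a x = a y] and covers the components outside the span of the [v_m]. *)
Lemma nsiwt_step_injective x y :
  normal_power sigma v ((r + 1) / 2) x + of_real a *: x
  = normal_power sigma v ((r + 1) / 2) y + of_real a *: y -> x = y.
Proof.
rewrite !normal_powerE => xy.
have r1 : 0 <= r + 1 by rewrite addr_ge0 // ltW.
have a0 : of_real a != 0 by rewrite gt_eqF // -(of_real0 R k) of_real_lt.
have dot_xy m : '[x, v m] = '[y, v m].
  have := congr1 (fun z => '[z, v m]) xy.
  rewrite !dotDl !dotZl !dot_diag //; try exact: bounded_powR_sigma.
  rewrite -!mulrDl -!of_realD => /mulfI; apply.
  rewrite gt_eqF // -(of_real0 R k) of_real_lt.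
  by rewrite ltr_wpDl // powR_ge0.
move: xy; rewrite (eq_diag (w' := fun m => sigma m `^ (r + 1)) (y := y)).
  by move=> /addrI/(scalerI a0).
by move=> m; rewrite dot_xy.
Qed.

(** One step multiplies the m-th error coefficient by
    [1 - s / (s + a) = a / (s + a)], with [s = sigma_m^(r+1)]. *)
Lemma nsiwt_step_diag p x : bounded_weights p ->
  nsiwt_step sigma v u a r (K x) (diag v (fun m => 1 - p m) x)
  = diag v (fun m =>
      1 - p m * (1 - sigma m `^ (r + 1) / (sigma m `^ (r + 1) + a))) x.
Proof.
move=> [B pB].
have r1 : 0 <= r + 1 by rewrite addr_ge0 // ltW.
have s0 m : 0 <= sigma m `^ (r + 1) by exact: powR_ge0.
set q := fun m => 1 - p m * _.
have qb : bounded_weights q.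
  exists (1 + B) => m; rewrite /q.
  apply: le_trans (ler_normB _ _) _; rewrite normr1 lerD2l normrM.
  apply: le_trans (pB m); rewrite ler_piMr // ger0_norm.
    by rewrite lerBlDr lerDl divr_ge0 // addr_ge0 // ltW.
  by rewrite subr_ge0 ler_pdivrMr ?ltr_wpDl // mul1r lerDl ltW.
have p1b : bounded_weights (fun m => 1 - p m).
  exists (1 + B) => m.
  by apply: le_trans (ler_normB _ _) _; rewrite normr1 lerD2l.
have qP :
    normal_power sigma v ((r + 1) / 2) (diag v q x) + of_real a *: diag v q x
    = weighted_adjoint sigma v u r (K x)
      + of_real a *: diag v (fun m => 1 - p m) x.
  have sb := bounded_powR_sigma r1.
  have sqb : bounded_weights (fun m => sigma m `^ (r + 1) * q m).
    have [[C hC] [D hD]] := (sb, qb); exists (C * D) => m.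
    by rewrite normrM ler_pM.
  have Zb w : bounded_weights w -> bounded_weights (fun m => a * w m).
    by move=> [C hC]; exists (a * C) => m; rewrite normrM gtr0_norm // ler_pM2l.
  rewrite normal_powerE weighted_adjointE diag_diag // -!diagZ //.
  rewrite -!diagD //; try exact: Zb.
  apply: eq_diag => m; congr (of_real _ * _); rewrite /q.
  have : sigma m `^ (r + 1) + a != 0 by rewrite gt_eqF // ltr_wpDl.
  by move=> ?; field.
rewrite /nsiwt_step; case: xgetP => [z _ /= zP|/(_ (diag v q x)) //].
by apply: nsiwt_step_injective; rewrite zP qP.
Qed.

End Step.

Variables (alpha r : nat -> R).
Hypotheses (alpha_gt0 : forall n, 0 < alpha n) (r_gt0 : forall n, 0 < r n).
Local Notation residual := (residual alpha r).

Lemma bounded_residual n : bounded_weights (fun m => residual (sigma m) n).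
Proof.
exists 1 => m; have /andP[r0 r1] := residual01 r alpha_gt0 (sigma m) n.
by rewrite ger0_norm.
Qed.

Lemma nsiwt_diag x n :
  nsiwt sigma v u alpha r (K x) n
  = diag v (fun m => 1 - residual (sigma m) n) x.
Proof.
elim: n => [|n IH] /=.
  rewrite -[LHS](scale0r (diag v (fun=> 1) x)) -(of_real0 R k) -diagZ //.
    by apply: eq_diag => m; rewrite /residual big_geq // subrr mul0r.
  exact: bounded_cst.
rewrite IH nsiwt_step_diag //; last exact: bounded_residual.
by apply: eq_diag => m; rewrite /residual big_nat_recr.
Qed.

(** Necessity comes from [x = v_m], whose m-th error coefficient is the residual
    at [sigma_m]; sufficiency is [cvg_diag0], as residuals are at most 1. *)
Lemma nsiwt_cvgP :
  (forall y, range K y -> nsiwt sigma v u alpha r y @ \oo --> moore_penrose K y)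
  <-> (forall m, residual (sigma m) @ \oo --> 0).
Proof.
split=> [cvg m|cvg _ [x _ <-]].
  have := cvg (K (v m)) (ex_intro2 _ _ _ I erefl).
  rewrite moore_penrose_K => /(cvg_dotl (a := v m)).
  rewrite dot_diag //; last exact: bounded_cst.
  rewrite vo eqxx mulr1.
  rewrite (_ : (fun n => _) = fun n => of_real (1 - residual (sigma m) n)).
    move=> /cvg_of_real h.
    rewrite (_ : residual _ = fun n => 1 - (1 - residual (sigma m) n)).
      by rewrite -[X in _ --> X](subrr (1 : R)); apply: cvgB h; exact: cvg_cst.
    by apply: funext => n; rewrite subKr.
  apply: funext => n; rewrite nsiwt_diag dot_diag ?vo ?eqxx ?mulr1 //.
  exists 1 => j; have := residual01 r alpha_gt0 (sigma j) n.
  by rewrite ler_norml; lra.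
rewrite moore_penrose_K.
have err n : nsiwt sigma v u alpha r (K x) n
    = diag v (fun=> 1) x - diag v (fun m => residual (sigma m) n) x.
  rewrite nsiwt_diag diagB //; first exact: bounded_cst.
  exact: bounded_residual.
rewrite (_ : nsiwt _ _ _ _ _ _ = fun n =>
  diag v (fun=> 1) x - diag v (fun m => residual (sigma m) n) x).
  rewrite -[X in _ --> X]subr0; apply: cvgB; first exact: cvg_cst.
  apply: (@cvg_diag0 _ _ _ _ vo _ _ 1) => // n m.
  by have /andP[r0 r1] := residual01 r alpha_gt0 (sigma m) n; rewrite ger0_norm.
by apply: funext => n; exact: err.
Qed.

End SVE.

Theorem theorem24 (R : realType) (k : scalar_kind) (X Y : hilbertType R k)
    (K : {linear X -> Y}) (K_compact : compact_operator K)
    (K_infinite : infinite_dim_range K)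
    (sigma : nat -> R) (v : nat -> X) (u : nat -> Y)
    (K_sve : singular_value_expansion K sigma v u)
    (alpha r : nat -> R)
    (alpha_gt0 : forall n, 0 < alpha n) (r_gt0 : forall n, 0 < r n) :
  (forall y : Y, range K y ->
     nsiwt sigma v u alpha r y @ \oo --> moore_penrose K y)
  <->
  (forall s : R, 0 < s ->
     ~ cvgn (fun n : nat =>
         \sum_(1 <= j < n.+1)
            s `^ (r j + 1) / (s `^ (r j + 1) + alpha j))).
Proof.
have sumE s : (fun n : nat => \sum_(1 <= j < n.+1)
      s `^ (r j + 1) / (s `^ (r j + 1) + alpha j))
    = series (fun j => filter_factor alpha r s j.+1).
  by apply: funext => n; rewrite /series /= big_add1.
have residualP s : residual alpha r s @ \oo --> 0
    <-> ~ cvgn (series (fun j => filter_factor alpha r s j.+1)).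
  by apply: prod_cvg0P => j; exact: filter_factor01.
split=> [cvg s s0|dvg].
  rewrite sumE => cvgs.
  have [m ms] : exists m, sigma m <= s.
    have /cvgr0Pnorm_lt/(_ s s0)[N _ hN] := sve_cvg0 K_sve.
    by exists N; apply: le_trans (ler_norm _) (ltW (hN N (leqnn N))).
  have := (nsiwt_cvgP K_sve alpha_gt0 r_gt0).1 cvg m.
  move=> /residualP; apply; apply: series_le_cvg cvgs => j.
  - by have /andP[] := filter_factor01 r alpha_gt0 (sigma m) j.+1.
  - by have /andP[] := filter_factor01 r alpha_gt0 s j.+1.
  - by apply: le_filter_factor => //; exact: (sve_gt0 K_sve).
apply/(nsiwt_cvgP K_sve alpha_gt0 r_gt0) => m; apply/residualP.
by rewrite -sumE; apply: dvg; exact: (sve_gt0 K_sve).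
Qed.
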